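(* For all $\mathsf h,\mathsf k\in\mathbb C$, the Verma module $M_V(\mathsf h,\mathsf k)$ of the affine ageing algebra $\widehat{\mathfrak{age}}(1)$ is not simple.
   Context: All vector spaces are over $\mathbb C$. The 1-spatial ageing algebra $\mathfrak{age}(1)$ is the complex Lie algebra with basis $\{e,h,p,q,z\}$ and brackets $[h,e]=2e$, $[h,p]=p$, $[h,q]=-q$, $[e,p]=0$, $[e,q]=p$, $[p,q]=z$, $[z,\mathfrak{age}(1)]=0$. The affine ageing algebra is $\widehat{\mathfrak{age}}(1)=\mathfrak{age}(1)\otimes\mathbb C[t,t^{-1}]\oplus\mathbb Ck$ with $[\alpha\otimes t^m,\beta\otimes t^n]=[\alpha,\beta]\otimes t^{m+n}+m(\alpha\mid\beta)\delta_{m+n,0}k$ and $k$ central, where $(\cdot\mid\cdot)$ is the symmetric bilinear form with $(h\mid h)=1$ and all other pairings of basis elements zero. Write $\alpha_n=\alpha\otimes t^n$; $\alpha_0$ is also written $\alpha$. Let $\widehat{\mathfrak{age}}(1)^+=\bigoplus_{n>0}\mathfrak{age}(1)\otimes t^n$, $\widehat{\mathfrak{age}}(1)^0=\mathfrak{age}(1)\oplus\mathbb Ck$, and $\widehat{\mathfrak{age}}(1)^{\ge0}=\widehat{\mathfrak{age}}(1)^+\oplus\widehat{\mathfrak{age}}(1)^0$. For $\mathsf h,\mathsf k\in\mathbb C$, let $\mathbb Cv$ be the one-dimensional $\widehat{\mathfrak{age}}(1)^{\ge0}$-module on which $h$ acts as $\mathsf h$, $k$ acts as $\mathsf k$, $\widehat{\mathfrak{age}}(1)^+$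 acts as zero, and (necessarily) $ev=pv=qv=zv=0$. The Verma module is $M_V(\mathsf h,\mathsf k)=U(\widehat{\mathfrak{age}}(1))\otimes_{U(\widehat{\mathfrak{age}}(1)^{\ge0})}\mathbb Cv$. *)

(* Defs.v *)
From HB Require Import structures.
From mathcomp Require Import all_boot all_order all_algebra.
From mathcomp Require Import ring.
From mathcomp Require Import finmap monalg boolp.
From mathcomp Require Import reals complex.

Set Implicit Arguments.
Unset Strict Implicit.
Unset Printing Implicit Defensive.

Import Order.TTheory GRing.Theory Num.Theory.
Local Open Scope ring_scope.
Local Open Scope quotient_scope.

HB.mixin Record Lmodule_isLieAlgebra (K : fieldType) L of GRing.Lmodule K L := {
  lie : L -> L -> L;
  lie_is_linearl : forall y, linear (lie^~ y);
  lie_is_linearr : forall x, linear (lie x);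
  lie_xx : forall x, lie x x = 0;
  lie_jacobi : forall x y z,
    lie x (lie y z) + lie y (lie z x) + lie z (lie x y) = 0
}.

#[short(type="lieAlgType")]
HB.structure Definition LieAlgebra (K : fieldType) :=
  { L of GRing.Lmodule K L & Lmodule_isLieAlgebra K L }.

Notation "[ 'lie' x , y ]" := (lie x y)
  (at level 0, x, y at level 99, format "[ 'lie'  x ,  y ]") : ring_scope.

Section LieTheory.
Variables (K : fieldType) (L : lieAlgType K).
Implicit Types x y z : L.

Lemma lieDl x y z : [lie x + y, z] = [lie x, z] + [lie y, z].
Proof. by have := lie_is_linearl z 1 x y; rewrite /= !scale1r. Qed.

Lemma lieDr z x y : [lie z, x + y] = [lie z, x] + [lie z, y].
Proof. by have := lie_is_linearr z 1 x y; rewrite /= !scale1r. Qed.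

Lemma lie0l z : [lie 0, z] = 0.
Proof. by apply: (addrI [lie 0, z]); rewrite -lieDl !addr0. Qed.

Lemma lie0r z : [lie z, 0] = 0.
Proof. by apply: (addrI [lie z, 0]); rewrite -lieDr !addr0. Qed.

Lemma lieZl a x z : [lie a *: x, z] = a *: [lie x, z].
Proof. by have := lie_is_linearl z a x 0; rewrite /= lie0l !addr0. Qed.

Lemma lieZr a z x : [lie z, a *: x] = a *: [lie z, x].
Proof. by have := lie_is_linearr z a x 0; rewrite /= lie0r !addr0. Qed.

Lemma lieC x y : [lie x, y] = - [lie y, x].
Proof.
apply/eqP; rewrite -subr_eq0 opprK; apply/eqP.
by have := lie_xx (x + y); rewrite lieDl !lieDr !lie_xx add0r addr0.
Qed.

End LieTheory.

Record lieHom (K : fieldType) (L1 L2 : lieAlgType K) := LieHom {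
  lie_hom :> L1 -> L2;
  lie_hom_linear : linear lie_hom;
  lie_hom_lie : {morph lie_hom : x y / [lie x, y]}
}.

Record lieRep (K : fieldType) (L : lieAlgType K) (V : lmodType K) := LieRep {
  lie_act :> L -> V -> V;
  lie_act_linearl : forall v, linear (lie_act^~ v);
  lie_act_linearr : forall x, linear (lie_act x);
  lie_act_lie : forall x y v,
    lie_act [lie x, y] v = lie_act x (lie_act y v) - lie_act y (lie_act x v)
}.

(* [envel L] is presented by generators and relations: expressions in the
   elements of [L] and the scalars of [K], modulo the least congruence for which
   they form an associative unital [K]-algebra in which [L] embeds linearly with
   [x, y] = xy - yx. *)

Inductive uexp (K : fieldType) (L : lieAlgType K) : Type :=
| UGen of L
| UConst of K
| UAdd of uexp L & uexp L
| UMul of uexp L & uexp L.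

Arguments UGen {K L}.
Arguments UConst {K L}.

Inductive ucong (K : fieldType) (L : lieAlgType K) : uexp L -> uexp L -> Prop :=
| ucong_refl a : ucong a a
| ucong_sym a b of ucong a b : ucong b a
| ucong_trans a b c of ucong a b & ucong b c : ucong a c
| ucong_add a a' b b' of ucong a a' & ucong b b' :
    ucong (UAdd a b) (UAdd a' b')
| ucong_mul a a' b b' of ucong a a' & ucong b b' :
    ucong (UMul a b) (UMul a' b')
| ucong_addA a b c : ucong (UAdd a (UAdd b c)) (UAdd (UAdd a b) c)
| ucong_addC a b : ucong (UAdd a b) (UAdd b a)
| ucong_add0 a : ucong (UAdd (UConst 0) a) a
| ucong_addN a : ucong (UAdd (UMul (UConst (-1)) a) a) (UConst 0)
| ucong_mulA a b c : ucong (UMul a (UMul b c)) (UMul (UMul a b) c)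
| ucong_mul1 a : ucong (UMul (UConst 1) a) a
| ucong_mulDl a b c : ucong (UMul (UAdd a b) c) (UAdd (UMul a c) (UMul b c))
| ucong_mulDr a b c : ucong (UMul a (UAdd b c)) (UAdd (UMul a b) (UMul a c))
| ucong_constD s t : ucong (UConst (s + t)) (UAdd (UConst s) (UConst t))
| ucong_constM s t : ucong (UConst (s * t)) (UMul (UConst s) (UConst t))
| ucong_constC s a : ucong (UMul (UConst s) a) (UMul a (UConst s))
| ucong_genD x y : ucong (UGen (x + y)) (UAdd (UGen x) (UGen y))
| ucong_genZ s x : ucong (UGen (s *: x)) (UMul (UConst s) (UGen x))
| ucong_lie x y : ucong (UGen [lie x, y])
    (UAdd (UMul (UGen x) (UGen y))
          (UMul (UConst (-1)) (UMul (UGen y) (UGen x)))).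

Section Envel.
Variables (K : fieldType) (L : lieAlgType K).

HB.instance Definition _ := gen_eqMixin (uexp L).
HB.instance Definition _ := gen_choiceMixin (uexp L).

Definition ucongb (a b : uexp L) : bool := `[< ucong a b >].

Lemma ucongb_refl : reflexive ucongb.
Proof. by move=> a; apply/asboolP/ucong_refl. Qed.

Lemma ucongb_sym : symmetric ucongb.
Proof. by move=> a b; apply/asboolP/asboolP; apply: ucong_sym. Qed.

Lemma ucongb_trans : transitive ucongb.
Proof.
move=> b a c /asboolP ab /asboolP bc; apply/asboolP.
exact: ucong_trans ab bc.
Qed.

Canonical ucong_equiv := EquivRel ucongb ucongb_refl ucongb_sym ucongb_trans.

Definition envel : Type := {eq_quot ucongb}.
HB.instance Definition _ := Choice.on envel.
HB.instance Definition _ : EqQuotient _ ucongb envel := EqQuotient.on envel.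

Lemma envel_eqP (a b : uexp L) : reflect (ucong a b) (\pi_envel a == \pi_envel b).
Proof. by rewrite piE; apply: asboolP. Qed.

Lemma ucongP (a b : uexp L) : ucong a b -> \pi_envel a = \pi_envel b.
Proof. by move=> ab; apply/eqP/envel_eqP. Qed.

Lemma ucong_repr (a : uexp L) : ucong (repr (\pi_envel a)) a.
Proof. by apply/envel_eqP; rewrite reprK. Qed.

Definition envel_const (s : K) : envel := \pi_envel (UConst s).
Definition envel_gen (x : L) : envel := \pi_envel (UGen x).
Definition envel_add (u v : envel) : envel :=
  \pi_envel (UAdd (repr u) (repr v)).
Definition envel_mul (u v : envel) : envel :=
  \pi_envel (UMul (repr u) (repr v)).
Definition envel_opp (u : envel) : envel := envel_mul (envel_const (-1)) u.

Lemma pi_uadd a b :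
  envel_add (\pi_envel a) (\pi_envel b) = \pi_envel (UAdd a b).
Proof. by apply/ucongP/ucong_add; apply: ucong_repr. Qed.

Lemma pi_umul a b :
  envel_mul (\pi_envel a) (\pi_envel b) = \pi_envel (UMul a b).
Proof. by apply/ucongP/ucong_mul; apply: ucong_repr. Qed.

Lemma envel_addA : associative envel_add.
Proof.
elim/quotW=> a; elim/quotW=> b; elim/quotW=> c.
rewrite (pi_uadd b c) (pi_uadd a b) (pi_uadd a) (pi_uadd _ c).
exact/ucongP/ucong_addA.
Qed.

Lemma envel_addC : commutative envel_add.
Proof.
by elim/quotW=> a; elim/quotW=> b; rewrite !pi_uadd; apply/ucongP/ucong_addC.
Qed.

Lemma envel_add0 : left_id (envel_const 0) envel_add.
Proof. by elim/quotW=> a; rewrite pi_uadd; apply/ucongP/ucong_add0. Qed.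

Lemma envel_addN : left_inverse (envel_const 0) envel_opp envel_add.
Proof.
elim/quotW=> a; rewrite /envel_opp (pi_umul _ a) (pi_uadd _ a).
exact/ucongP/ucong_addN.
Qed.

HB.instance Definition _ :=
  GRing.isZmodule.Build envel envel_addA envel_addC envel_add0 envel_addN.

Lemma pi_uaddE a b : \pi_envel (UAdd a b) = \pi_envel a + \pi_envel b.
Proof. by rewrite -pi_uadd. Qed.

Lemma envel_mulA : associative envel_mul.
Proof.
elim/quotW=> a; elim/quotW=> b; elim/quotW=> c.
rewrite (pi_umul b c) (pi_umul a b) (pi_umul a) (pi_umul _ c).
exact/ucongP/ucong_mulA.
Qed.

Lemma envel_mul1 : left_id (envel_const 1) envel_mul.
Proof. by elim/quotW=> a; rewrite pi_umul; apply/ucongP/ucong_mul1. Qed.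

Lemma envel_1mul : right_id (envel_const 1) envel_mul.
Proof.
elim/quotW=> a; rewrite pi_umul; apply/ucongP.
by apply: ucong_trans (ucong_mul1 a); apply/ucong_sym/ucong_constC.
Qed.

Lemma envel_mulDl : left_distributive envel_mul +%R.
Proof.
elim/quotW=> a; elim/quotW=> b; elim/quotW=> c.
rewrite -pi_uaddE (pi_umul _ c) (pi_umul a c) (pi_umul b c) -pi_uaddE.
exact/ucongP/ucong_mulDl.
Qed.

Lemma envel_mulDr : right_distributive envel_mul +%R.
Proof.
elim/quotW=> a; elim/quotW=> b; elim/quotW=> c.
rewrite -pi_uaddE (pi_umul a _) (pi_umul a b) (pi_umul a c) -pi_uaddE.
exact/ucongP/ucong_mulDr.
Qed.

Fixpoint ucounit (a : uexp L) : K :=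
  match a with
  | UGen _ => 0
  | UConst s => s
  | UAdd a b => ucounit a + ucounit b
  | UMul a b => ucounit a * ucounit b
  end.

Lemma ucounit_cong a b : ucong a b -> ucounit a = ucounit b.
Proof. by elim=> //= *; try congruence; ring. Qed.

Lemma envel_1neq0 : envel_const 1 != 0.
Proof.
apply/negP=> /envel_eqP/ucounit_cong /= /eqP.
by rewrite oner_eq0.
Qed.

HB.instance Definition _ := GRing.Zmodule_isNzRing.Build envel
  envel_mulA envel_mul1 envel_1mul envel_mulDl envel_mulDr envel_1neq0.

Lemma pi_umulE a b : \pi_envel (UMul a b) = \pi_envel a * \pi_envel b.
Proof. by rewrite -pi_umul. Qed.

Definition envel_scale (s : K) (u : envel) : envel := envel_const s * u.

Lemma envel_scaleA s t u :
  envel_scale s (envel_scale t u) = envel_scale (s * t) u.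
Proof.
by rewrite /envel_scale mulrA -pi_umulE; congr (_ * _);
  apply/ucongP/ucong_sym/ucong_constM.
Qed.

Lemma envel_scale1 : left_id 1 envel_scale.
Proof. by move=> u; rewrite /envel_scale mul1r. Qed.

Lemma envel_scaleDr : right_distributive envel_scale +%R.
Proof. by move=> s u v; rewrite /envel_scale mulrDr. Qed.

Lemma envel_scaleDl u : {morph envel_scale^~ u : s t / s + t}.
Proof.
move=> s t; rewrite /envel_scale -mulrDl -pi_uaddE; congr (_ * _).
exact/ucongP/ucong_constD.
Qed.

HB.instance Definition _ := GRing.Zmodule_isLmodule.Build K envel
  envel_scaleA envel_scale1 envel_scaleDr envel_scaleDl.

Lemma envel_scaleAl (s : K) (u v : envel) : s *: (u * v) = s *: u * v.
Proof. exact: mulrA. Qed.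

HB.instance Definition _ := GRing.Lmodule_isLalgebra.Build K envel envel_scaleAl.

Lemma envel_constC s u : envel_const s * u = u * envel_const s.
Proof.
elim/quotW: u => a; rewrite -!pi_umulE; exact/ucongP/ucong_constC.
Qed.

Lemma envel_scaleAr (s : K) (u v : envel) : s *: (u * v) = u * (s *: v).
Proof.
change (envel_const s * (u * v) = u * (envel_const s * v)).
by rewrite !mulrA envel_constC.
Qed.

HB.instance Definition _ := GRing.Lalgebra_isAlgebra.Build K envel envel_scaleAr.

Lemma envel_constE s : envel_const s = s%:A.
Proof. by rewrite -[LHS]mulr1. Qed.

Lemma envel_gen_linear : linear envel_gen.
Proof.
move=> s x y; transitivity (envel_gen (s *: x) + envel_gen y).
  by rewrite -pi_uaddE; apply/ucongP/ucong_genD.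
congr (_ + _); transitivity (envel_const s * envel_gen x) => //.
by rewrite -pi_umulE; apply/ucongP/ucong_genZ.
Qed.

Lemma envel_gen_lie x y :
  envel_gen [lie x, y] = envel_gen x * envel_gen y - envel_gen y * envel_gen x.
Proof.
transitivity (\pi_envel (UAdd (UMul (UGen x) (UGen y))
          (UMul (UConst (-1)) (UMul (UGen y) (UGen x))))).
  exact/ucongP/ucong_lie.
rewrite pi_uaddE !pi_umulE -/(envel_const _) envel_constE.
by rewrite scaleN1r mulN1r.
Qed.

End Envel.

Section EnvelMap.
Variables (K : fieldType) (L1 L2 : lieAlgType K) (f : lieHom L1 L2).

Fixpoint uexp_map (a : uexp L1) : uexp L2 :=
  match a with
  | UGen x => UGen (f x)
  | UConst s => UConst s
  | UAdd a b => UAdd (uexp_map a) (uexp_map b)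
  | UMul a b => UMul (uexp_map a) (uexp_map b)
  end.

Lemma uexp_map_cong a b : ucong a b -> ucong (uexp_map a) (uexp_map b).
Proof.
have fD x y : f (x + y) = f x + f y.
  by have := lie_hom_linear f 1 x y; rewrite !scale1r.
have f0 : f 0 = 0 by apply: (addrI (f 0)); rewrite -fD !addr0.
have fZ s x : f (s *: x) = s *: f x.
  by have := lie_hom_linear f s x 0; rewrite f0 !addr0.
elim=> /=; try by constructor.
- by move=> *; apply: ucong_trans; eauto.
- by move=> x y; rewrite fD; constructor.
- by move=> s x; rewrite fZ; constructor.
- by move=> x y; rewrite lie_hom_lie; constructor.
Qed.

Definition envel_map (u : envel L1) : envel L2 :=
  \pi_(envel L2) (uexp_map (repr u)).

Lemma envel_map_pi a :
  envel_map (\pi_(envel L1) a) = \pi_(envel L2) (uexp_map a).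
Proof. exact/ucongP/uexp_map_cong/ucong_repr. Qed.

Lemma envel_map_is_zmod_morphism : zmod_morphism envel_map.
Proof.
have mapD : {morph envel_map : u v / u + v}.
  elim/quotW=> a; elim/quotW=> b.
  by rewrite -pi_uaddE !envel_map_pi /= pi_uaddE.
move=> u v; apply: (addIr (envel_map v)).
by rewrite -mapD !subrK.
Qed.

Lemma envel_map_is_monoid_morphism : monoid_morphism envel_map.
Proof.
split=> [|u v]; first exact: envel_map_pi.
elim/quotW: u => a; elim/quotW: v => b.
by rewrite -pi_umulE !envel_map_pi /= pi_umulE.
Qed.

HB.instance Definition _ := GRing.isZmodMorphism.Build
  (envel L1) (envel L2) envel_map envel_map_is_zmod_morphism.
HB.instance Definition _ := GRing.isMonoidMorphism.Build
  (envel L1) (envel L2) envel_map envel_map_is_monoid_morphism.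

End EnvelMap.

Definition rep_module (K : fieldType) (L : lieAlgType K) (V : lmodType K)
  (r : lieRep L V) : Type := V.

Section RepModule.
Variables (K : fieldType) (L : lieAlgType K) (V : lmodType K) (r : lieRep L V).

HB.instance Definition _ := GRing.Zmodule.on (rep_module r).

Fixpoint uexp_act (a : uexp L) (v : V) : V :=
  match a with
  | UGen x => r x v
  | UConst s => s *: v
  | UAdd a b => uexp_act a v + uexp_act b v
  | UMul a b => uexp_act a (uexp_act b v)
  end.

Lemma uexp_act_linear a : linear (uexp_act a).
Proof.
elim: a => [x|s|a IHa b IHb|a IHa b IHb] t v w /=.
- exact: lie_act_linearr.
- by rewrite scalerDr !scalerA mulrC.
- by rewrite IHa IHb scalerDr addrACA.
- by rewrite IHb IHa.
Qed.

Lemma uexp_actD a v w : uexp_act a (v + w) = uexp_act a v + uexp_act a w.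
Proof. by have := uexp_act_linear a 1 v w; rewrite !scale1r. Qed.

Lemma uexp_actZ a s v : uexp_act a (s *: v) = s *: uexp_act a v.
Proof.
have a0 : uexp_act a 0 = 0.
  by apply: (addrI (uexp_act a 0)); rewrite -uexp_actD !addr0.
by have := uexp_act_linear a s v 0; rewrite a0 !addr0.
Qed.

Lemma uexp_act_cong a b : ucong a b -> uexp_act a =1 uexp_act b.
Proof.
have rD x y v : r (x + y) v = r x v + r y v.
  by have := lie_act_linearl r v 1 x y; rewrite /= !scale1r.
have r0 v : r 0 v = 0 by apply: (addrI (r 0 v)); rewrite -rD !addr0.
have rZ s x v : r (s *: x) v = s *: r x v.
  by have := lie_act_linearl r v s x 0; rewrite /= r0 !addr0.
elim=> {a b} /=.
- by [].
- by move=> a b _ IH v.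
- by move=> a b c _ IH1 _ IH2 v; rewrite IH1 IH2.
- by move=> a a' b b' _ IH1 _ IH2 v; rewrite IH1 IH2.
- by move=> a a' b b' _ IH1 _ IH2 v; rewrite IH1 IH2.
- by move=> a b c v; rewrite addrA.
- by move=> a b v; rewrite addrC.
- by move=> a v; rewrite scale0r add0r.
- by move=> a v; rewrite scaleN1r addNr scale0r.
- by [].
- by move=> a v; rewrite scale1r.
- by [].
- by move=> a b c v; rewrite uexp_actD.
- by move=> s t v; rewrite scalerDl.
- by move=> s t v; rewrite scalerA.
- by move=> s a v; rewrite uexp_actZ.
- by move=> x y v; rewrite rD.
- by move=> s x v; rewrite rZ.
- by move=> x y v; rewrite lie_act_lie scaleN1r.
Qed.

Definition envel_act (u : envel L) (v : rep_module r) : rep_module r :=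
  uexp_act (repr u) v.

Lemma envel_act_pi a v : envel_act (\pi_(envel L) a) v = uexp_act a v.
Proof. exact/uexp_act_cong/ucong_repr. Qed.

Lemma envel_actA u w v : envel_act u (envel_act w v) = envel_act (u * w) v.
Proof.
by elim/quotW: u => a; elim/quotW: w => b; rewrite -pi_umulE !envel_act_pi.
Qed.

Lemma envel_act1 : left_id 1 envel_act.
Proof. by move=> v; rewrite envel_act_pi /= scale1r. Qed.

Lemma envel_actDr : right_distributive envel_act +%R.
Proof. by move=> u v w; apply: uexp_actD. Qed.

Lemma envel_actDl v : {morph envel_act^~ v : u w / u + w}.
Proof.
by elim/quotW=> a; elim/quotW=> b; rewrite -pi_uaddE !envel_act_pi.
Qed.

HB.instance Definition _ := GRing.Zmodule_isLmodule.Build (envel L)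
  (rep_module r) envel_actA envel_act1 envel_actDr envel_actDl.

End RepModule.

(* For a ring morphism [f : A -> B] and a left [A]-module [N], [tensor f N] is
   B (x)_A N, with [B] a right [A]-module through [f]: the abelian group
   generated by the symbols b (x) n modulo biadditivity and
   b f(a) (x) n = b (x) a n, with [B] acting by left multiplication. *)

Inductive texp (A B : nzRingType) (f : {rmorphism A -> B}) (N : lmodType A) :
    Type :=
| TPure of B & N
| TZero
| TOpp of texp f N
| TAdd of texp f N & texp f N.

Arguments TPure {A B f N}.
Arguments TZero {A B f N}.

Inductive tcong (A B : nzRingType) (f : {rmorphism A -> B}) (N : lmodType A) :
    texp f N -> texp f N -> Prop :=
| tcong_refl s : tcong s s
| tcong_sym s t of tcong s t : tcong t s
| tcong_trans s t u of tcong s t & tcong t u : tcong s u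
| tcong_opp s s' of tcong s s' : tcong (TOpp s) (TOpp s')
| tcong_add s s' t t' of tcong s s' & tcong t t' :
    tcong (TAdd s t) (TAdd s' t')
| tcong_addA s t u : tcong (TAdd s (TAdd t u)) (TAdd (TAdd s t) u)
| tcong_addC s t : tcong (TAdd s t) (TAdd t s)
| tcong_add0 s : tcong (TAdd TZero s) s
| tcong_addN s : tcong (TAdd (TOpp s) s) TZero
| tcong_pureDl b b' n :
    tcong (TPure (b + b') n) (TAdd (TPure b n) (TPure b' n))
| tcong_pureDr b n n' :
    tcong (TPure b (n + n')) (TAdd (TPure b n) (TPure b n'))
| tcong_balanced b a n : tcong (TPure (b * f a) n) (TPure b (a *: n)).

Section Tensor.
Variables (A B : nzRingType) (f : {rmorphism A -> B}) (N : lmodType A).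

HB.instance Definition _ := gen_eqMixin (texp f N).
HB.instance Definition _ := gen_choiceMixin (texp f N).

Definition tcongb (s t : texp f N) : bool := `[< tcong s t >].

Lemma tcongb_refl : reflexive tcongb.
Proof. by move=> s; apply/asboolP/tcong_refl. Qed.

Lemma tcongb_sym : symmetric tcongb.
Proof. by move=> s t; apply/asboolP/asboolP; apply: tcong_sym. Qed.

Lemma tcongb_trans : transitive tcongb.
Proof.
move=> t s u /asboolP st /asboolP tu; apply/asboolP.
exact: tcong_trans st tu.
Qed.

Canonical tcong_equiv := EquivRel tcongb tcongb_refl tcongb_sym tcongb_trans.

Definition tensor : Type := {eq_quot tcongb}.
HB.instance Definition _ := Choice.on tensor.
HB.instance Definition _ : EqQuotient _ tcongb tensor := EqQuotient.on tensor.

Lemma tensor_eqP (a b : texp f N) : reflect (tcong a b) (\pi_tensor a == \pi_tensor b).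
Proof. by rewrite piE; apply: asboolP. Qed.

Lemma tcongP (s t : texp f N) : tcong s t -> \pi_tensor s = \pi_tensor t.
Proof. by move=> st; apply/eqP/tensor_eqP. Qed.

Lemma tcong_repr (s : texp f N) : tcong (repr (\pi_tensor s)) s.
Proof. by apply/tensor_eqP; rewrite reprK. Qed.

Definition pure_tensor (b : B) (n : N) : tensor := \pi_tensor (TPure b n).
Definition tensor_zero : tensor := \pi_tensor TZero.
Definition tensor_opp (x : tensor) : tensor := \pi_tensor (TOpp (repr x)).
Definition tensor_add (x y : tensor) : tensor :=
  \pi_tensor (TAdd (repr x) (repr y)).

Lemma pi_topp s : tensor_opp (\pi_tensor s) = \pi_tensor (TOpp s).
Proof. exact/tcongP/tcong_opp/tcong_repr. Qed.

Lemma pi_tadd s t :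
  tensor_add (\pi_tensor s) (\pi_tensor t) = \pi_tensor (TAdd s t).
Proof. by apply/tcongP/tcong_add; apply: tcong_repr. Qed.

Lemma tensor_addA : associative tensor_add.
Proof.
elim/quotW=> s; elim/quotW=> t; elim/quotW=> u.
rewrite (pi_tadd t u) (pi_tadd s t) (pi_tadd s) (pi_tadd _ u).
exact/tcongP/tcong_addA.
Qed.

Lemma tensor_addC : commutative tensor_add.
Proof.
by elim/quotW=> s; elim/quotW=> t; rewrite !pi_tadd; apply/tcongP/tcong_addC.
Qed.

Lemma tensor_add0 : left_id tensor_zero tensor_add.
Proof. by elim/quotW=> s; rewrite pi_tadd; apply/tcongP/tcong_add0. Qed.

Lemma tensor_addN : left_inverse tensor_zero tensor_opp tensor_add.
Proof.
by elim/quotW=> s; rewrite (pi_topp s) (pi_tadd _ s); apply/tcongP/tcong_addN.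
Qed.

HB.instance Definition _ := GRing.isZmodule.Build tensor
  tensor_addA tensor_addC tensor_add0 tensor_addN.

Fixpoint texp_scale (b : B) (s : texp f N) : texp f N :=
  match s with
  | TPure b' n => TPure (b * b') n
  | TZero => TZero
  | TOpp s => TOpp (texp_scale b s)
  | TAdd s t => TAdd (texp_scale b s) (texp_scale b t)
  end.

Lemma texp_scale_cong b s t :
  tcong s t -> tcong (texp_scale b s) (texp_scale b t).
Proof.
elim=> /=; try by constructor.
- by move=> *; apply: tcong_trans; eauto.
- by move=> b1 b2 n; rewrite mulrDr; constructor.
- by move=> b' a n; rewrite mulrA; constructor.
Qed.

Definition tensor_scale (b : B) (x : tensor) : tensor :=
  \pi_tensor (texp_scale b (repr x)).

Lemma tensor_scale_pi b s :
  tensor_scale b (\pi_tensor s) = \pi_tensor (texp_scale b s).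
Proof. exact/tcongP/texp_scale_cong/tcong_repr. Qed.

Lemma pi_toppE s : \pi_tensor (TOpp s) = - \pi_tensor s.
Proof. by rewrite -pi_topp. Qed.

Lemma pi_taddE s t : \pi_tensor (TAdd s t) = \pi_tensor s + \pi_tensor t.
Proof. by rewrite -pi_tadd. Qed.

Lemma tensor_scaleA b c x :
  tensor_scale b (tensor_scale c x) = tensor_scale (b * c) x.
Proof.
elim/quotW: x => s.
rewrite (tensor_scale_pi c s) (tensor_scale_pi b) (tensor_scale_pi _ s).
congr (\pi_tensor _).
by elim: s => //= [b' n|s ->|s -> t ->] //; rewrite mulrA.
Qed.

Lemma tensor_scale1 : left_id 1 tensor_scale.
Proof.
elim/quotW=> s; rewrite tensor_scale_pi; congr (\pi_tensor _).
by elim: s => //= [b' n|s ->|s -> t ->] //; rewrite mul1r.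
Qed.

Lemma tensor_scaleDr : right_distributive tensor_scale +%R.
Proof.
move=> b; elim/quotW=> s; elim/quotW=> t.
by rewrite -pi_taddE !tensor_scale_pi /= pi_taddE.
Qed.

Lemma tensor_scaleDl x : {morph tensor_scale^~ x : b c / b + c}.
Proof.
move=> b c; elim/quotW: x => s.
rewrite (tensor_scale_pi _ s) (tensor_scale_pi b s) (tensor_scale_pi c s).
elim: s => [b' n||s IH|s IHs t IHt] /=.
- by rewrite mulrDl -pi_taddE; apply/tcongP/tcong_pureDl.
- by rewrite -[\pi_tensor TZero]/(0 : tensor) addr0.
- by rewrite !pi_toppE IH opprD.
- by rewrite !pi_taddE IHs IHt addrACA.
Qed.

HB.instance Definition _ := GRing.Zmodule_isLmodule.Build B tensor
  tensor_scaleA tensor_scale1 tensor_scaleDr tensor_scaleDl.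

Lemma pure_tensorDl b b' n :
  pure_tensor (b + b') n = pure_tensor b n + pure_tensor b' n.
Proof. by rewrite -pi_taddE; apply/tcongP/tcong_pureDl. Qed.

Lemma pure_tensorDr b n n' :
  pure_tensor b (n + n') = pure_tensor b n + pure_tensor b n'.
Proof. by rewrite -pi_taddE; apply/tcongP/tcong_pureDr. Qed.

Lemma pure_tensor_balanced b a n :
  pure_tensor (b * f a) n = pure_tensor b (a *: n).
Proof. exact/tcongP/tcong_balanced. Qed.

Lemma scale_pure_tensor (b b' : B) n :
  b *: pure_tensor b' n = pure_tensor (b * b') n.
Proof. exact: tensor_scale_pi. Qed.

End Tensor.

Definition simple_module (A : nzRingType) (M : lmodType A) : Prop :=
  (exists x : M, x != 0) /\
  forall S : {pred M}, GRing.submod_closed S -> S =i pred1 0 \/ S =i predT.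

Record invForm (K : fieldType) (g : lieAlgType K) := InvForm {
  inv_form :> g -> g -> K;
  inv_form_linearl : forall y, linear_for *%R (inv_form^~ y);
  inv_form_sym : forall x y, inv_form x y = inv_form y x;
  inv_form_inv : forall x y z, inv_form [lie x, y] z = inv_form x [lie y, z]
}.

(* g (x) K[t, t^-1]: the finitely supported maps [int -> g]; the element
   [<< x *g n >>] is x (x) t^n. *)
Definition loop (K : fieldType) (g : lieAlgType K) : Type := {malg g[int]}.

Section Loop.
Variables (K : fieldType) (g : lieAlgType K).

HB.instance Definition _ := GRing.Zmodule.on (loop g).

Definition loop_scale (s : K) (x : loop g) : loop g :=
  [malg n in msupp x => s *: x@_n].

Lemma loop_scaleE s x n : (loop_scale s x)@_n = s *: x@_n.
Proof. by rewrite mcoeffE; case: msuppP => //; rewrite scaler0. Qed.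

Lemma loop_scaleA s t x : loop_scale s (loop_scale t x) = loop_scale (s * t) x.
Proof. by apply/malgP=> n; rewrite !loop_scaleE scalerA. Qed.

Lemma loop_scale1 : left_id 1 loop_scale.
Proof. by move=> x; apply/malgP=> n; rewrite loop_scaleE scale1r. Qed.

Lemma loop_scaleDr : right_distributive loop_scale +%R.
Proof.
by move=> s x y; apply/malgP=> n; rewrite !(loop_scaleE, mcoeffD) scalerDr.
Qed.

Lemma loop_scaleDl x : {morph loop_scale^~ x : s t / s + t}.
Proof.
by move=> s t; apply/malgP=> n; rewrite !(loop_scaleE, mcoeffD) scalerDl.
Qed.

HB.instance Definition _ := GRing.Zmodule_isLmodule.Build K (loop g)
  loop_scaleA loop_scale1 loop_scaleDr loop_scaleDl.

End Loop.

Lemma addr3ACA (V : zmodType) (a a' b b' c c' : V) :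
  (a + a') + (b + b') + (c + c') = (a + b + c) + (a' + b' + c').
Proof. by rewrite (addrACA a a' b b') (addrACA (a + b)). Qed.

(* The second component is the coefficient of the central element. *)
Definition affine (K : fieldType) (g : lieAlgType K) (B : invForm g) : Type :=
  (loop g * K^o)%type.

Section Affine.
Variables (K : fieldType) (g : lieAlgType K) (B : invForm g).

HB.instance Definition _ := GRing.Lmodule.on (affine B).

Definition aff_gen (x : g) (n : int) : affine B := (<< x *g n >>, 0).
Definition aff_central : affine B := (0, 1).

(* The bracket of x (x) t^m and y (x) t^n. *)
Definition aff_lie_gen (m n : int) (x y : g) : affine B :=
  aff_gen [lie x, y] (m + n)
  + (m%:~R * B x y * (m + n == 0)%:R) *: aff_central.

Definition aff_lie (x y : affine B) : affine B :=
  \sum_(m <- msupp x.1) \sum_(n <- msupp y.1)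
    aff_lie_gen m n (x.1@_m) (y.1@_n).

Lemma aff_genD n : {morph aff_gen^~ n : x y / x + y}.
Proof. by move=> x y; rewrite /aff_gen monalgUD; congr pair; rewrite addr0. Qed.

Lemma aff_genZ n s x : aff_gen (s *: x) n = s *: aff_gen x n.
Proof.
congr pair; last by rewrite scaler0.
by apply/malgP=> k; rewrite loop_scaleE !mcoeffU; case: eqP; rewrite ?scaler0.
Qed.

Lemma aff_gen0 n : aff_gen 0 n = 0.
Proof. by rewrite /aff_gen monalgU0. Qed.

Lemma aff_ind (P : affine B -> Prop) :
  (forall x y, P x -> P y -> P (x + y)) ->
  (forall a n, P (aff_gen a n)) -> (forall s, P (s *: aff_central)) ->
  forall x, P x.
Proof.
move=> PD Pgen Pk [x s].
have -> : (x, s) = (\sum_(n <- msupp x) aff_gen x@_n n) + (s : K) *: aff_central.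
  apply/pair_equal_spec; split.
    rewrite /= scaler0 addr0.
    rewrite (raddf_sum (fst : {additive affine B -> loop g})) /=.
    exact: monalgE.
  rewrite /= (raddf_sum (snd : {additive affine B -> K^o})) /=.
  by rewrite big1 // add0r [RHS]mulr1.
apply: (PD) => //; elim: (enum_fset _) => [|n r IH].
  by rewrite big_nil -(aff_gen0 0).
by rewrite big_cons; apply: PD.
Qed.

Lemma invFormDl : forall x y z, B (x + y) z = B x z + B y z.
Proof. by move=> x y z; have := inv_form_linearl B z 1 x y; rewrite /= scale1r mul1r. Qed.

Lemma invForm0l z : B 0 z = 0.
Proof. by apply: (addrI (B 0 z)); rewrite -invFormDl !addr0. Qed.

Lemma invFormZl s x z : B (s *: x) z = s * B x z.
Proof. by have := inv_form_linearl B z s x 0; rewrite /= invForm0l !addr0. Qed.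

Lemma aff_lie_gen_linearl m n y : linear (fun x => aff_lie_gen m n x y).
Proof.
move=> s x x'; rewrite /aff_lie_gen lieDl lieZl aff_genD aff_genZ.
rewrite scalerDr addrACA; congr (_ + _).
rewrite scalerA -scalerDl invFormDl invFormZl; congr (_ *: _); ring.
Qed.

Lemma aff_lie_genC m n x y : aff_lie_gen m n x y = - aff_lie_gen n m y x.
Proof.
rewrite /aff_lie_gen lieC (addrC n m) -scaleN1r aff_genZ scaleN1r opprD.
congr (_ + _); rewrite -scaleNr; congr (_ *: _).
have [/eqP mn|_] := boolP (m + n == 0); last by rewrite !mulr0 oppr0.
have -> : m = - n by apply/eqP; rewrite -addr_eq0 mn.
by rewrite inv_form_sym !mulr1 mulrNz mulNr.
Qed.

Lemma aff_lie_gen_linearr m n x : linear (aff_lie_gen m n x).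
Proof.
move=> s y y'; rewrite aff_lie_genC aff_lie_gen_linearl.
by rewrite opprD -scalerN -!aff_lie_genC.
Qed.

Lemma aff_lie_gen0l m n y : aff_lie_gen m n 0 y = 0.
Proof. by rewrite /aff_lie_gen lie0l aff_gen0 invForm0l mulr0 mul0r scale0r addr0. Qed.

Lemma aff_lie_gen0r m n x : aff_lie_gen m n x 0 = 0.
Proof. by rewrite aff_lie_genC aff_lie_gen0l oppr0. Qed.

Lemma aff_lieEw (d1 d2 : {fset int}) x y :
  (msupp x.1 `<=` d1)%fset -> (msupp y.1 `<=` d2)%fset ->
  aff_lie x y =
    \sum_(m <- d1) \sum_(n <- d2) aff_lie_gen m n (x.1@_m) (y.1@_n).
Proof.
move=> s1 s2; rewrite /aff_lie.
rewrite (big_fset_incl _ s1) => [|m _ /mcoeff_outdom ->]; last first.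
  by rewrite big1 // => n _; rewrite aff_lie_gen0l.
apply: eq_bigr => m _; apply: big_fset_incl => // n _ /mcoeff_outdom ->.
by rewrite aff_lie_gen0r.
Qed.

Lemma aff_lie_linearl y : linear (aff_lie^~ y).
Proof.
move=> s x x'; pose w : affine B := s *: x + x'.
pose d := (msupp w.1 `|` (msupp x.1 `|` msupp x'.1))%fset.
have s0 : (msupp w.1 `<=` d)%fset by apply: fsubsetUl.
have s1 : (msupp x.1 `<=` d)%fset.
  by apply: fsubset_trans (fsubsetUr _ _); apply: fsubsetUl.
have s2 : (msupp x'.1 `<=` d)%fset.
  by apply: fsubset_trans (fsubsetUr _ _); apply: fsubsetUr.
have sy := fsubset_refl (msupp y.1).
rewrite (aff_lieEw s0 sy) (aff_lieEw s1 sy) (aff_lieEw s2 sy).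
rewrite scaler_sumr -big_split /=; apply: eq_bigr => m _.
rewrite scaler_sumr -big_split /=; apply: eq_bigr => n _.
by rewrite mcoeffD loop_scaleE aff_lie_gen_linearl.
Qed.

Lemma aff_lieC x y : aff_lie x y = - aff_lie y x.
Proof.
rewrite /aff_lie exchange_big -sumrN; apply: eq_bigr => m _.
by rewrite -sumrN; apply: eq_bigr => n _; rewrite aff_lie_genC.
Qed.

Lemma aff_lie_linearr x : linear (aff_lie x).
Proof.
move=> s y y'; rewrite aff_lieC (aff_lie_linearl x s y y') /=.
by rewrite opprD -scalerN -!aff_lieC.
Qed.

Lemma aff_lieDl x x' y : aff_lie (x + x') y = aff_lie x y + aff_lie x' y.
Proof. by have := aff_lie_linearl y 1 x x'; rewrite /= !scale1r. Qed.

Lemma aff_lieDr x y y' : aff_lie x (y + y') = aff_lie x y + aff_lie x y'.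
Proof. by have := aff_lie_linearr x 1 y y'; rewrite /= !scale1r. Qed.

Lemma aff_lie_central s x : aff_lie (s *: aff_central) x = 0.
Proof. by rewrite /aff_lie /= scaler0 msupp0 big_seq_fset0. Qed.

Lemma aff_lier_central s x : aff_lie x (s *: aff_central) = 0.
Proof. by rewrite aff_lieC aff_lie_central oppr0. Qed.

Lemma aff_lier0 x : aff_lie x 0 = 0.
Proof. by rewrite -{1}(scale0r aff_central) aff_lier_central. Qed.

Lemma aff_lieE m n x y :
  aff_lie (aff_gen x m) (aff_gen y n) = aff_lie_gen m n x y.
Proof.
rewrite (@aff_lieEw [fset m]%fset [fset n]%fset) ?msuppU_le //.
by rewrite !big_seq_fset1 /= !mcoeffUU.
Qed.

Lemma aff_lie_xx x : aff_lie x x = 0.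
Proof.
elim/aff_ind: x => [x y Px Py|a n|s]; last exact: aff_lie_central.
  by rewrite aff_lieDl !aff_lieDr Px Py add0r addr0 aff_lieC addNr.
rewrite aff_lieE /aff_lie_gen lie_xx aff_gen0 add0r.
have [/eqP|_] := boolP (n + n == 0); last by rewrite mulr0 scale0r.
by move/eqP; rewrite -mulr2n mulrn_eq0 /= => /eqP ->; rewrite !mul0r scale0r.
Qed.

Lemma aff_lie_jacobi x y z :
  aff_lie x (aff_lie y z) + aff_lie y (aff_lie z x) + aff_lie z (aff_lie x y)
  = 0.
Proof.
elim/aff_ind: x y z => [x x' Px Px' y z|x l|s y z].
- have := congr2 +%R (Px y z) (Px' y z); rewrite addr0 => <-.
  by rewrite !(aff_lieDl, aff_lieDr) addr3ACA.
- elim/aff_ind=> [y y' Py Py' z|y m|s z].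
  + have := congr2 +%R (Py z) (Py' z); rewrite addr0 => <-.
    by rewrite !(aff_lieDl, aff_lieDr) addr3ACA.
  + elim/aff_ind=> [z z' Pz Pz'|z n|s].
    * have := congr2 +%R Pz Pz'; rewrite addr0 => <-.
      by rewrite !(aff_lieDl, aff_lieDr) addr3ACA.
    * rewrite !aff_lieE /aff_lie_gen !aff_lieDr !aff_lier_central !addr0.
      rewrite !aff_lieE /aff_lie_gen.
      have -> : m + (n + l) = l + (m + n) by ring.
      have -> : n + (l + m) = l + (m + n) by ring.
      rewrite addr3ACA -!aff_genD lie_jacobi aff_gen0 add0r.
      rewrite -!scalerDl -(scale0r aff_central); congr (_ *: _).
      have [/eqP lmn|_] := boolP (_ == 0); last by rewrite !mulr0 !addr0.
      have Byx : B y [lie z, x] = B x [lie y, z].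
        by rewrite -inv_form_inv inv_form_sym.
      have Bzx : B z [lie x, y] = B x [lie y, z].
        by rewrite inv_form_sym inv_form_inv.
      by rewrite Byx Bzx !mulr1 -!mulrDl -!intrD -addrA lmn mul0r.
    * by rewrite !aff_lie_central !aff_lier_central !aff_lier0 !addr0.
  + by rewrite !aff_lie_central !aff_lier_central !aff_lier0 !addr0.
- by rewrite !aff_lie_central !aff_lier_central !aff_lier0 !addr0.
Qed.

HB.instance Definition _ := Lmodule_isLieAlgebra.Build K (affine B)
  aff_lie_linearl aff_lie_linearr aff_lie_xx aff_lie_jacobi.

(* The span of the x (x) t^n with n >= 0 and of the central element. *)
Definition aff_ge0_pred : {pred affine B} :=
  [pred x : affine B | [forall n : msupp x.1, 0 <= fsval n]].

Lemma aff_ge0P x :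
  reflect (forall n, n < 0 -> x.1@_n = 0) (x \in aff_ge0_pred).
Proof.
apply: (iffP forallP) => [x0 n|x0 [n nx] /=].
  rewrite ltNge => nn; apply: mcoeff_outdom; apply: contra nn => nx.
  exact: (x0 [` nx]%fset).
by rewrite leNgt; apply: contraTN nx => /x0 /eqP; rewrite mcoeff_eq0.
Qed.

Lemma aff_ge0_submod_closed : GRing.submod_closed aff_ge0_pred.
Proof.
split=> [|s x y /aff_ge0P x0 /aff_ge0P y0]; apply/aff_ge0P => n n0.
  by rewrite mcoeff0.
by rewrite mcoeffD loop_scaleE x0 // y0 // scaler0 addr0.
Qed.

HB.instance Definition _ :=
  GRing.isSubmodClosed.Build K (affine B) aff_ge0_pred aff_ge0_submod_closed.

Lemma aff_ge0_lie x y : x \in aff_ge0_pred -> y \in aff_ge0_pred ->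
  [lie x, y] \in aff_ge0_pred.
Proof.
move=> /forallP x0 /forallP y0; rewrite -[[lie x, y]]/(aff_lie x y) /aff_lie.
rewrite big_seq; apply: rpred_sum => m mx.
rewrite big_seq; apply: rpred_sum => n ny.
have m0 := x0 [` mx]%fset; have n0 := y0 [` ny]%fset.
apply/aff_ge0P=> k k0; rewrite /= mcoeffD loop_scaleE mcoeff0 scaler0 addr0.
rewrite mcoeffU; case: eqP => // mnk; move: k0.
by rewrite -mnk ltNge addr_ge0.
Qed.

Definition aff_ge0 : Type := {x : affine B | x \in aff_ge0_pred}.
HB.instance Definition _ := SubChoice.on aff_ge0.
HB.instance Definition _ := [SubChoice_isSubLmodule of aff_ge0 by <:].

Definition aff_ge0_val (x : aff_ge0) : affine B := val x.

Lemma aff_ge0_val_inj : injective aff_ge0_val.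
Proof. exact: val_inj. Qed.

Lemma aff_ge0_val_linear : linear aff_ge0_val.
Proof. by move=> s x y; rewrite /aff_ge0_val linearP. Qed.

Lemma aff_ge0_valD x y : aff_ge0_val (x + y) = aff_ge0_val x + aff_ge0_val y.
Proof. exact: raddfD. Qed.

Lemma aff_ge0_val0 : aff_ge0_val 0 = 0.
Proof. exact: raddf0. Qed.

Definition aff_ge0_lie_op (x y : aff_ge0) : aff_ge0 :=
  Sub [lie aff_ge0_val x, aff_ge0_val y] (aff_ge0_lie (valP x) (valP y)).

Lemma aff_ge0_val_lie_op x y :
  aff_ge0_val (aff_ge0_lie_op x y) = [lie aff_ge0_val x, aff_ge0_val y].
Proof. exact: SubK. Qed.

Lemma aff_ge0_lie_linearl y : linear (aff_ge0_lie_op^~ y).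
Proof.
move=> s x x'; apply: aff_ge0_val_inj.
by rewrite !(aff_ge0_val_linear, aff_ge0_val_lie_op) lieDl lieZl.
Qed.

Lemma aff_ge0_lie_linearr x : linear (aff_ge0_lie_op x).
Proof.
move=> s y y'; apply: aff_ge0_val_inj.
by rewrite !(aff_ge0_val_linear, aff_ge0_val_lie_op) lieDr lieZr.
Qed.

Lemma aff_ge0_lie_xx x : aff_ge0_lie_op x x = 0.
Proof.
by apply: aff_ge0_val_inj; rewrite aff_ge0_val_lie_op lie_xx aff_ge0_val0.
Qed.

Lemma aff_ge0_lie_jacobi x y z :
  aff_ge0_lie_op x (aff_ge0_lie_op y z) + aff_ge0_lie_op y (aff_ge0_lie_op z x)
  + aff_ge0_lie_op z (aff_ge0_lie_op x y) = 0.
Proof.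
apply: aff_ge0_val_inj.
by rewrite !(aff_ge0_valD, aff_ge0_val_lie_op) aff_ge0_val0 lie_jacobi.
Qed.

HB.instance Definition _ := Lmodule_isLieAlgebra.Build K aff_ge0
  aff_ge0_lie_linearl aff_ge0_lie_linearr aff_ge0_lie_xx aff_ge0_lie_jacobi.

Definition aff_ge0_incl : lieHom aff_ge0 (affine B) :=
  LieHom aff_ge0_val_linear aff_ge0_val_lie_op.

End Affine.

Inductive age_basis := Be | Bh | Bp | Bq | Bz.

Definition age_basis_code (b : age_basis) : 'I_5 :=
  match b with
  | Be => inord 0 | Bh => inord 1 | Bp => inord 2 | Bq => inord 3 | Bz => inord 4
  end.

Definition age_basis_decode (i : 'I_5) : age_basis :=
  nth Be [:: Be; Bh; Bp; Bq; Bz] i.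

Lemma age_basis_codeK : cancel age_basis_code age_basis_decode.
Proof. by case; rewrite /age_basis_decode inordK. Qed.

HB.instance Definition _ := Finite.copy age_basis (can_type age_basis_codeK).

Lemma age_basis_eqE (a b : age_basis) : (a == b) =
  match a, b with
  | Be, Be | Bh, Bh | Bp, Bp | Bq, Bq | Bz, Bz => true
  | _, _ => false
  end.
Proof. by apply/eqP/idP => [->|]; [case: b|case: a b => -[]]. Qed.

Lemma big_age_basis (V : zmodType) (F : age_basis -> V) :
  \sum_b F b = F Be + F Bh + F Bp + F Bq + F Bz.
Proof.
have codeK : cancel age_basis_decode age_basis_code.
  move=> i; apply/val_inj; rewrite /age_basis_decode.
  by case: i => -[|[|[|[|[|i]]]]] //= lti; rewrite inordK.
have bij : {on [pred _ | true], bijective age_basis_decode}.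
  by apply: onW_bij; exists age_basis_code; [exact: codeK|exact: age_basis_codeK].
rewrite (reindex age_basis_decode) //= !big_ord_recl big_ord0.
by rewrite addr0 !addrA.
Qed.

Definition age (K : fieldType) : Type := {ffun age_basis -> K^o}.

Section Age.
Variable K : fieldType.

HB.instance Definition _ := GRing.Lmodule.on (age K).

Definition age_elt (b : age_basis) : age K := [ffun c => (b == c)%:R].

(* [age_table a b - age_table b a] is the bracket of the basis elements. *)
Definition age_table (a b : age_basis) : age K :=
  match a, b with
  | Bh, Be => 2%:R *: age_elt Be
  | Bh, Bp => age_elt Bp
  | Bh, Bq => - age_elt Bq
  | Be, Bq => age_elt Bp
  | Bp, Bq => age_elt Bz
  | _, _ => 0
  end.

Definition age_lie (x y : age K) : age K :=
  \sum_a \sum_b (x a * y b : K) *: (age_table a b - age_table b a).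

Lemma age_lieE (x y : age K) c : age_lie x y c =
  match c with
  | Be => 2%:R * (x Bh * y Be - x Be * y Bh)
  | Bh => 0
  | Bp => (x Bh * y Bp - x Bp * y Bh) + (x Be * y Bq - x Bq * y Be)
  | Bq => - (x Bh * y Bq - x Bq * y Bh)
  | Bz => x Bp * y Bq - x Bq * y Bp
  end :> K.
Proof.
pose t a b : K := match a, b, c with
  | Bh, Be, Be => 2%:R | Bh, Bp, Bp => 1 | Bh, Bq, Bq => - 1
  | Be, Bq, Bp => 1 | Bp, Bq, Bz => 1 | _, _, _ => 0 end.
have tE a b : age_table a b c = t a b.
  rewrite /t; case: a; case: b; rewrite /= ?ffunE ?age_basis_eqE //;
    by case: c {t}; rewrite /GRing.scale /= ?mulr0 ?mulr1 ?oppr0.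
transitivity (\sum_a \sum_b (x a * y b : K) * (t a b - t b a)).
  rewrite /age_lie sum_ffunE; apply: eq_bigr => a _.
  by rewrite sum_ffunE; apply: eq_bigr => b _; rewrite !ffunE !tE.
by rewrite !big_age_basis /t; case: c {t tE} => /=; ring.
Qed.

Lemma age_lie_linearl y : linear (age_lie^~ y).
Proof.
move=> s x x'; apply/ffunP=> c; rewrite ffunE ffunE !age_lieE !ffunE.
by case: c; rewrite /GRing.scale /=; ring.
Qed.

Lemma age_lie_linearr x : linear (age_lie x).
Proof.
move=> s y y'; apply/ffunP=> c; rewrite ffunE ffunE !age_lieE !ffunE.
by case: c; rewrite /GRing.scale /=; ring.
Qed.

Lemma age_lie_xx x : age_lie x x = 0.
Proof. by apply/ffunP=> c; rewrite age_lieE !ffunE; case: c; ring. Qed.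

Lemma age_lie_jacobi x y z :
  age_lie x (age_lie y z) + age_lie y (age_lie z x) + age_lie z (age_lie x y)
  = 0.
Proof.
apply/ffunP=> c; rewrite !ffunE !age_lieE.
by case: c; ring.
Qed.

HB.instance Definition _ := Lmodule_isLieAlgebra.Build K (age K)
  age_lie_linearl age_lie_linearr age_lie_xx age_lie_jacobi.

Definition age_form_fun (x y : age K) : K := x Bh * y Bh.

Lemma age_form_linearl y : linear_for *%R (age_form_fun^~ y).
Proof.
by move=> s x x'; rewrite /age_form_fun !ffunE /GRing.scale /=; ring.
Qed.

Lemma age_form_sym x y : age_form_fun x y = age_form_fun y x.
Proof. exact: mulrC. Qed.

Lemma age_form_inv x y z :
  age_form_fun [lie x, y] z = age_form_fun x [lie y, z].
Proof.
rewrite /age_form_fun -[[lie x, y]]/(age_lie x y) -[[lie y, z]]/(age_lie y z).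
by rewrite !age_lieE mul0r mulr0.
Qed.

Definition age_form : invForm (age K) :=
  InvForm age_form_linearl age_form_sym age_form_inv.

End Age.

Definition aff_age (K : fieldType) : lieAlgType K := affine (age_form K).
Definition aff_age_ge0 (K : fieldType) : lieAlgType K := aff_ge0 (age_form K).

Section Verma.
Variables (K : fieldType) (hw kw : K).

(* On v, h_0 acts as [hw], the central element as [kw], and every other x (x) t^n
   of the basis as 0. *)
Definition verma_weight (x : aff_age_ge0 K) : K :=
  hw * (aff_ge0_val x).1@_0 Bh + kw * (aff_ge0_val x).2.

Definition verma_act (x : aff_age_ge0 K) (v : K^o) : K^o := verma_weight x * v.

Lemma verma_weight_linear s x y :
  verma_weight (s *: x + y) = s * verma_weight x + verma_weight y.
Proof.
rewrite /verma_weight aff_ge0_val_linear /= mcoeffD loop_scaleE !ffunE.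
by rewrite /GRing.scale /=; ring.
Qed.

Lemma verma_weight_lie x y : verma_weight [lie x, y] = 0.
Proof.
have x0 := valP x; have y0 := valP y.
rewrite /verma_weight aff_ge0_val_lie_op.
pose w (u : affine (age_form K)) : K := hw * u.1@_0 Bh + kw * u.2.
have wD u v : w (u + v) = w u + w v.
  by rewrite /w /= mcoeffD ffunE; ring.
have w0 : w 0 = 0 by rewrite /w /= mcoeff0 ffunE; ring.
rewrite -/(w _) -[[lie _, _]]/(aff_lie _ _) /aff_lie (big_morph w wD w0).
rewrite big_seq big1 // => m mx; rewrite (big_morph w wD w0).
rewrite big_seq big1 // => n ny.
have m0 : 0 <= m := forallP x0 [` mx]%fset.
have n0 : 0 <= n := forallP y0 [` ny]%fset.
rewrite wD /w /= loop_scaleE mcoeff0 scaler0 ffunE !mulr0 !add0r.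
rewrite mcoeffU /GRing.scale /= mulr1.
have [/eqP mn|_] := boolP (m + n == 0); last first.
  by rewrite !mulr0n ffunE !mulr0 !addr0.
have -> : m = 0.
  by apply/eqP; move: mn => /eqP; rewrite paddr_eq0 // => /andP[].
rewrite !mul0r mulr0 !addr0 !mulr1n.
by rewrite -[[lie _, _]]/(age_lie _ _) age_lieE mulr0.
Qed.

Lemma verma_act_linearl v : linear (verma_act^~ v).
Proof.
by move=> s x y; rewrite /verma_act verma_weight_linear mulrDl -mulrA.
Qed.

Lemma verma_act_linearr x : linear (verma_act x).
Proof. by move=> s v w; rewrite /verma_act /GRing.scale /=; ring. Qed.

Lemma verma_act_lie x y v : verma_act [lie x, y] v =
  verma_act x (verma_act y v) - verma_act y (verma_act x v).
Proof. by rewrite /verma_act verma_weight_lie; ring. Qed.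

Definition verma_rep : lieRep (aff_age_ge0 K) K^o :=
  LieRep verma_act_linearl verma_act_linearr verma_act_lie.

Definition verma_incl : lieHom (aff_age_ge0 K) (aff_age K) :=
  aff_ge0_incl (age_form K).

Definition verma : lmodType (envel (aff_age K)) :=
  tensor (envel_map verma_incl) (rep_module verma_rep).

End Verma.

(* Main.v *)
Require Import Defs.
From HB Require Import structures.
From mathcomp Require Import all_boot all_order all_algebra.
From mathcomp Require Import zify ring.
From mathcomp Require Import finmap monalg boolp functions.
From mathcomp Require Import reals complex.

Set Implicit Arguments.
Unset Strict Implicit.
Unset Printing Implicit Defensive.

(** Why a Verma module is never simple.

    Let v be the generator.  The largest quotient of the Verma module on which
    the ideal of all e_n, p_n, q_n, z_n acts as zero is a Fock module of the
    Heisenberg algebra of the h_n, where e_{-1} v dies while v survives.  So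
    the submodule generated by e_{-1} v is proper, and the only question is
    whether e_{-1} v is nonzero in the Verma module.  Rather than prove a
    Poincare-Birkhoff-Witt theorem, one exhibits a single module V with a
    highest weight vector of the given weights on which e_{-1} does not vanish,
    together with a submodule Q of V containing e_{-1} v but not v.  The
    universal property of the Verma module ([verma_lift]) gives a map to V
    sending generator to highest weight vector.  If the Verma module were
    simple, the preimage of Q would be zero ([simple_module_preim]),
    contradicting e_{-1} v != 0 in V.

    In V the elements p, q, z act as zero (they span an ideal of the ageing
    algebra), so V amounts to operators H_n, E_n with
    [H_m, H_n] = m kw delta_{m+n,0}, [H_m, E_n] = 2 E_{m+n}, [E_m, E_n] = 0
    ([age_rep]).  Arbitrary weights are reached by a tensor product of two
    modules: a Fock module carrying the level kw and the weight hw, on which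
    the E_n are zero, and one fixed module of level and highest weight 0 on
    which E_{-1} v != 0 ([loop_module]).  The latter has vectors u_j (j an
    integer) and w_l (l < 0), with the convention w_l = 0 for l >= 0, and
    - for m >= 0, h_m u_j = 0 and h_m w_l = 2 w_{l+m};
    - for m < 0, h_m u_j = -2 u_{j-m} and h_m w_l = 0;
    - e_n u_j = w_{n-j} and e_n w_l = 0.
    Its highest weight vector is u_0, since e_n u_0 = w_n; and the w_l span the
    submodule from which Q comes.  The negative modes h_m have to act
    nontrivially on the u_j: e_0 u_0 = 0 forces
    e_0 h_{-1} u_0 = -2 e_{-1} u_0.

    Both factors are modelled by arbitrary functions on the index set of a
    basis, that is by formal infinite sums: each coefficient of the image of a
    vector depends on finitely many coefficients of this vector, so the formulas
    still make sense and no finiteness has to be carried along.  The argument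
    works over every field. *)

Import Order.TTheory GRing.Theory.
Local Open Scope ring_scope.
Local Open Scope quotient_scope.

(** * Extension of scalars and enveloping algebras *)

(** The universal property of an extension of scalars: a semilinear map from N
    extends to a B-linear map from the tensor product. *)
Section TensorLift.
Variables (A B : nzRingType) (f : {rmorphism A -> B}).
Variables (N : lmodType A) (P : lmodType B) (g : N -> P).
Hypothesis gD : {morph g : x y / x + y}.
Hypothesis gZ : forall a n, g (a *: n) = f a *: g n.

Fixpoint texp_lift (s : texp f N) : P :=
  match s with
  | TPure b n => b *: g n
  | TZero => 0
  | TOpp s => - texp_lift s
  | TAdd s t => texp_lift s + texp_lift t
  end.

Lemma texp_lift_cong s t : tcong s t -> texp_lift s = texp_lift t.
Proof.
elim=> //= {s t}.
- by move=> s t u _ -> _ ->.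
- by move=> s s' _ ->.
- by move=> s s' t t' _ -> _ ->.
- by move=> s t u; rewrite addrA.
- by move=> s t; rewrite addrC.
- by move=> s; rewrite add0r.
- by move=> s; rewrite addNr.
- by move=> b b' n; rewrite scalerDl.
- by move=> b n n'; rewrite gD scalerDr.
- by move=> b a n; rewrite gZ scalerA.
Qed.

Definition tensor_lift (x : tensor f N) : P := texp_lift (repr x).

Lemma tensor_lift_pi s : tensor_lift (\pi_(tensor f N) s) = texp_lift s.
Proof. exact/texp_lift_cong/tcong_repr. Qed.

Lemma tensor_lift_pure b n : tensor_lift (pure_tensor f b n) = b *: g n.
Proof. exact: tensor_lift_pi. Qed.

Lemma tensor_lift_is_linear : linear tensor_lift.
Proof.
move=> b; elim/quotW=> s; elim/quotW=> t.
rewrite -[b *: _]/(tensor_scale b _) tensor_scale_pi -pi_taddE.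
rewrite !tensor_lift_pi /=; congr (_ + _); elim: s => /= [b' n||s ->|s -> u ->].
- by rewrite scalerA.
- by rewrite scaler0.
- by rewrite scalerN.
- by rewrite scalerDr.
Qed.

End TensorLift.

(** The preimage of Q is a submodule which misses [x], so it is zero; this turns
    simplicity of M into a statement about any module that M maps to. *)
Lemma simple_module_preim (A : nzRingType) (M P : lmodType A)
    (phi : {linear M -> P}) (Q : {pred P}) (x y : M) :
  simple_module M -> GRing.submod_closed Q ->
  phi x \notin Q -> phi y \in Q -> phi y = 0.
Proof.
move=> [_ /(_ [pred u | phi u \in Q]) preimP] [Q0 QP] xQ yQ.
have [|pre0|preT] := preimP.
- split=> [|a u w]; rewrite !inE ?linear0 // => Qu Qw.
  by rewrite linearP QP.
- have := pre0 y; rewrite !inE yQ => /esym/eqP ->; exact: linear0.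
- by have := preT x; rewrite !inE (negPf xQ).
Qed.

Section RepModuleTheory.
Variables (K : fieldType) (L : lieAlgType K) (V : lmodType K) (r : lieRep L V).

Lemma scale_pi_uexp a (v : rep_module r) :
  \pi_(envel L) a *: v = uexp_act r a v.
Proof. exact: envel_act_pi. Qed.

Lemma envel_gen_act (x : L) (v : rep_module r) : envel_gen x *: v = r x v.
Proof. exact: scale_pi_uexp. Qed.

(** Lie-stable subspaces are submodules over the enveloping algebra, which is
    generated by the Lie algebra. *)
Lemma envel_act_stable (Q : {pred V}) :
  GRing.submod_closed Q -> (forall x v, v \in Q -> r x v \in Q) ->
  @GRing.submod_closed (envel L) (rep_module r) Q.
Proof.
move=> [Q0 QP] Qr; split=> // u v w Qv Qw.
have QD x y : x \in Q -> y \in Q -> x + y \in Q.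
  by move=> Qx Qy; rewrite -[x]scale1r QP.
apply: (QD) => //; elim/quotW: u => a.
rewrite scale_pi_uexp.
elim: a v Qv => /= [x|s|a IHa b IHb|a IHa b IHb] v Qv.
- exact: Qr.
- by rewrite -[_ *: _]addr0 QP.
- by apply: (QD); [apply: IHa | apply: IHb].
- by apply: IHa; apply: IHb.
Qed.

End RepModuleTheory.

(** * The universal property of the Verma module *)

Definition verma_gen (K : fieldType) (hw kw : K) : verma hw kw :=
  pure_tensor (envel_map (verma_incl K)) 1
    ((1 : K) : rep_module (verma_rep hw kw)).

(** Frobenius reciprocity: a highest weight vector [v] of a module is the image
    of the generator of the Verma module. *)
Section VermaLift.
Variables (K : fieldType) (hw kw : K) (V : lmodType K).
Variables (r : lieRep (aff_age K) V) (v : V).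
Hypothesis vP : forall x : aff_age_ge0 K,
  r (verma_incl K x) v = verma_weight hw kw x *: v.

Definition verma_line (s : rep_module (verma_rep hw kw)) : rep_module r :=
  (s : K) *: v.

Lemma verma_lineD : {morph verma_line : s t / s + t}.
Proof.
move=> s t.
by rewrite /verma_line -[_ + _ : rep_module r]/(_ + _ : V) -scalerDl.
Qed.

Lemma verma_lineZ a s :
  verma_line (a *: s) = envel_map (verma_incl K) a *: verma_line s.
Proof.
elim/quotW: a => a; rewrite envel_map_pi !scale_pi_uexp.
elim: a s => [x|t|a IHa b IHb|a IHa b IHb] s /=.
- rewrite /verma_line -[RHS]/(uexp_act r (UGen (verma_incl K x)) (_ *: v)).
  rewrite uexp_actZ /= vP scalerA.
  by rewrite -[verma_act _ _ _ _]/(verma_weight hw kw x * (s : K)) mulrC.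
- by rewrite /verma_line scalerA.
- by rewrite -IHa -IHb -verma_lineD.
- by rewrite -IHb -IHa.
Qed.

Lemma verma_lift : exists phi : {linear verma hw kw -> rep_module r},
  phi (verma_gen hw kw) = v.
Proof.
pose phi : verma hw kw -> rep_module r := tensor_lift verma_line.
pose lin := GRing.isLinear.Build _ _ _ _ phi
  (tensor_lift_is_linear verma_lineD verma_lineZ).
exists (HB.pack phi lin : {linear verma hw kw -> rep_module r}).
rewrite -[LHS]/(tensor_lift verma_line (verma_gen hw kw)).
rewrite (tensor_lift_pure verma_lineD verma_lineZ) scale1r.
exact: (scale1r v).
Qed.

End VermaLift.

(** * Modules on which p, q and z act as zero *)

(** Two families of operators with the commutation relations of the modes of h
    and e make a module of level [kw]. *)
Section AgeRep.
Variables (K : fieldType) (V : lmodType K).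
Variables (H E : int -> {linear V -> V}) (kw : K).
Hypothesis HH : forall m n v,
  H m (H n v) - H n (H m v) = (m%:~R * kw * (m + n == 0)%:R) *: v.
Hypothesis HE : forall m n v,
  H m (E n v) - E n (H m v) = 2%:R *: E (m + n) v.
Hypothesis EE : forall m n v, E m (E n v) = E n (E m v).

Definition age_mode (n : int) (a : age K) (v : V) : V :=
  (a Bh : K) *: H n v + (a Be : K) *: E n v.

Definition age_act (x : affine (age_form K)) (v : V) : V :=
  \sum_(n <- msupp x.1) age_mode n x.1@_n v + ((x.2 : K) * kw) *: v.

Lemma age_mode0 n v : age_mode n 0 v = 0.
Proof. by rewrite /age_mode !ffunE !scale0r addr0. Qed.

Lemma age_modeP n s a b v :
  age_mode n (s *: a + b) v = s *: age_mode n a v + age_mode n b v.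
Proof.
have saE c : (s *: a + b) c = s * (a c : K) + b c :> K by rewrite !ffunE.
by rewrite /age_mode !saE !scalerDl scalerDr !scalerA addrACA.
Qed.

(** A common summation range is what makes linearity in [x] visible, as the
    support of a sum varies. *)
Lemma age_actEw (d : {fset int}) x v : (msupp x.1 `<=` d)%fset ->
  age_act x v = \sum_(n <- d) age_mode n x.1@_n v + ((x.2 : K) * kw) *: v.
Proof.
move=> sd; rewrite /age_act (big_fset_incl _ sd) // => n _ /mcoeff_outdom ->.
by rewrite age_mode0.
Qed.

Lemma age_act_linearl v : linear (age_act^~ v).
Proof.
move=> s x y; pose w : affine (age_form K) := s *: x + y.
pose d := (msupp w.1 `|` (msupp x.1 `|` msupp y.1))%fset.
have sw : (msupp w.1 `<=` d)%fset by apply: fsubsetUl.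
have sx : (msupp x.1 `<=` d)%fset.
  by apply: fsubset_trans (fsubsetUr _ _); apply: fsubsetUl.
have sy : (msupp y.1 `<=` d)%fset.
  by apply: fsubset_trans (fsubsetUr _ _); apply: fsubsetUr.
rewrite (age_actEw v sw) (age_actEw v sx) (age_actEw v sy) scalerDr addrACA.
congr (_ + _).
  rewrite scaler_sumr -big_split; apply: eq_bigr => n _.
  by rewrite mcoeffD loop_scaleE age_modeP.
by rewrite scalerA -scalerDl mulrDl mulrA.
Qed.

Lemma age_act_linearr x : linear (age_act x).
Proof.
move=> s v w; rewrite /age_act !scalerDr addrACA; congr (_ + _).
  rewrite scaler_sumr -big_split; apply: eq_bigr => n _.
  rewrite /age_mode (linearP (H n)) (linearP (E n)) /= !scalerDr addrACA.
  by rewrite !scalerA ![s * _]mulrC.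
by rewrite !scalerA mulrC.
Qed.

Lemma age_act_gen a n v : age_act (aff_gen (age_form K) a n) v = age_mode n a v.
Proof.
rewrite (@age_actEw [fset n]%fset) ?msuppU_le // big_seq_fset1 /= mcoeffUU.
by rewrite mul0r scale0r addr0.
Qed.

Lemma age_act_central s v :
  age_act (s *: aff_central (age_form K)) v = (s * kw) *: v.
Proof.
by rewrite /age_act /= scaler0 msupp0 big_seq_fset0 add0r [_ *: 1]mulr1.
Qed.

(** Both sides are bilinear, so only x (x) t^m and y (x) t^n and the central
    element have to be examined, and there the relations apply. *)
Lemma age_act_lie x y v : age_act [lie x, y] v =
  age_act x (age_act y v) - age_act y (age_act x v).
Proof.
have actDl u w t : age_act (u + w) t = age_act u t + age_act w t.
  by have := age_act_linearl t 1 u w; rewrite /= !scale1r.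
have actDr u t t' : age_act u (t + t') = age_act u t + age_act u t'.
  by have := age_act_linearr u 1 t t'; rewrite !scale1r.
have act0 u : age_act u 0 = 0.
  by apply: (addrI (age_act u 0)); rewrite -actDr !addr0.
have actZ s u t : age_act u (s *: t) = s *: age_act u t.
  by have := age_act_linearr u s t 0; rewrite act0 !addr0.
have actc0 t : age_act 0 t = 0.
  by apply: (addrI (age_act 0 t)); rewrite -actDl !addr0.
elim/aff_ind: x y => [x x' Px Px' y|a m|s y].
- by rewrite lieDl !actDl Px Px' actDr [in RHS]opprD [RHS]addrACA.
- elim/aff_ind=> [y y' Py Py'|b n|s].
  + by rewrite lieDr !actDl Py Py' actDr [in RHS]opprD [RHS]addrACA.
  + rewrite -[[lie _, _]]/(aff_lie _ _) aff_lieE /aff_lie_gen actDl.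
    rewrite age_act_central !age_act_gen /age_mode.
    rewrite -[[lie a, b]]/(age_lie a b) !age_lieE scale0r add0r.
    rewrite !(linearD (H _), linearD (E _)) !(linearZ_LR (H _)).
    rewrite !(linearZ_LR (E _)) /=.
    (* Every product is put in one fixed order, so that all products cancel and
       only the commutators remain. *)
    have -> : H m (H n v) = H n (H m v) + (m%:~R * kw * (m + n == 0)%:R) *: v.
      by rewrite -HH addrC subrK.
    have -> : H m (E n v) = E n (H m v) + 2%:R *: E (m + n) v.
      by rewrite -HE addrC subrK.
    have -> : H n (E m v) = E m (H n v) + 2%:R *: E (m + n) v.
      by rewrite [m + n]addrC -HE addrC subrK.
    rewrite (EE m n).
    rewrite !scalerDr !scalerA.
    have cancel (A B C D V' W W' : V) :
        (W - W') + V' = (A + V' + (B + W) + (C + D)) - (A + (C + W') + (B + D)).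
      apply: (addIr (A + (C + W') + (B + D))); rewrite subrK.
      by rewrite [LHS](AC ((2*1)*((1*2)*2)) ((((4*3)*(7*1))*(5*8))*(6*2))) /=
        subrr addr0.
    rewrite !(mulrC (b _) (a _)) -cancel -scalerBl.
    by congr (_ *: _ + _ *: _); rewrite /age_form_fun; ring.
  + by rewrite -[[lie _, _]]/(aff_lie _ _) aff_lier_central actc0
    !age_act_central actZ subrr.
- by rewrite -[[lie _, _]]/(aff_lie _ _) aff_lie_central actc0
    !age_act_central actZ subrr.
Qed.

Definition age_rep : lieRep (aff_age K) V :=
  LieRep age_act_linearl age_act_linearr age_act_lie.

Lemma age_act_stable (Q : {pred V}) (x : affine (age_form K)) v :
  GRing.submod_closed Q ->
  (forall n, {homo H n : w / w \in Q}) ->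
  (forall n, {homo E n : w / w \in Q}) ->
  v \in Q -> age_act x v \in Q.
Proof.
move=> [Q0 QP] HQ EQ Qv.
have QZ s w : w \in Q -> s *: w \in Q by move=> Qw; rewrite -[_ *: w]addr0 QP.
have QD w w' : w \in Q -> w' \in Q -> w + w' \in Q.
  by move=> Qw Qw'; rewrite -[w]scale1r QP.
apply: (QD); last exact: QZ.
elim/big_ind: _ => // n _; apply: QD; apply: QZ; [exact: HQ | exact: EQ].
Qed.

End AgeRep.

(** * The Fock module with coefficients *)

Section Fock.
Variables (K : fieldType) (hw kw : K) (L : lmodType K).

(** Formal series in variables x_1, x_2, ... with coefficients in L; the value
    at [a] is the coefficient of the divided power monomial x^a / a!.  The entry
    [a 0] belongs to no variable and is never moved. *)
Definition fock : Type := (nat -> nat) -> L.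
HB.instance Definition _ := GRing.Lmodule.on fock.

Definition mode_shift (n : int) (a : nat -> nat) : nat -> nat :=
  fun i => if i == `|n|%N then (a i + (0 < n)%R - (n < 0)%R)%N else a i.

Definition mode_coef (n : int) (a : nat -> nat) : K :=
  if n < 0 then (a `|n|%N)%:R else if n == 0 then hw else n%:~R * kw.

(** With divided powers, [heis n] is n kw d/dx_n for n > 0, multiplication by
    x_{-n} for n < 0, and the scalar [hw] for n = 0: multiplication by x_i has
    coefficient a_i f(a - eps_i) at [a], which makes the case a_i = 0
    automatic. *)
Definition heis (n : int) (f : fock) : fock :=
  fun a => mode_coef n a *: f (mode_shift n a).

Lemma mode_coef_shift m n a : `|m|%N != `|n|%N ->
  mode_coef n (mode_shift m a) = mode_coef n a.
Proof. by move=> mn; rewrite /mode_coef /mode_shift eq_sym (negPf mn). Qed.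

Lemma mode_shiftC m n a : `|m|%N != `|n|%N ->
  mode_shift m (mode_shift n a) = mode_shift n (mode_shift m a).
Proof.
move=> mn; apply/funext=> i; rewrite /mode_shift.
by case: (i =P `|m|%N) => // ->; rewrite (negPf mn).
Qed.

Lemma heis_is_linear n : linear (heis n).
Proof.
move=> s f g; apply/funext=> a.
rewrite -[LHS]/(mode_coef n a *:
  (s *: f (mode_shift n a) + g (mode_shift n a))).
rewrite -[RHS]/(s *: heis n f a + heis n g a) /heis scalerDr !scalerA.
by rewrite [s * _]mulrC.
Qed.

HB.instance Definition _ n := GRing.isLinear.Build K fock fock *:%R
  (heis n) (heis_is_linear n).

(** The one nontrivial Heisenberg relation, [d/dx_m, x_m] = 1.  It comes out as
    (a_m + 1) - a_m = 1. *)
Lemma heis_pair (m : nat) f a : (0 < m)%N ->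
  heis m (heis (- m%:Z) f) a - heis (- m%:Z) (heis m f) a = (m%:R * kw) *: f a.
Proof.
case: m => // m _; rewrite -NegzE /heis !scalerA /mode_coef /=.
set up := mode_shift m.+1 a; set down := mode_shift (Negz m) a.
have -> : mode_shift (Negz m) up = a.
  apply/funext=> i; rewrite /up /mode_shift /=.
  by case: eqP => // _; rewrite addn0 subn0 addn1 subn1.
have -> : up m.+1 = (a m.+1).+1.
  by rewrite /up /mode_shift /= eqxx subn0 addn1.
(* For a_m = 0 lowering truncates, but then the coefficient a_m is zero. *)
have [am0|am0] := posnP (a m.+1).
  by rewrite am0 mul0r scale0r subr0 mulr1.
have -> : mode_shift m.+1 down = a.
  apply/funext=> i; rewrite /down /mode_shift /=.
  by case: eqP => // ->; rewrite addn0 subn0 subn1 addn1 prednK.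
by rewrite -scalerBl; congr (_ *: _); rewrite -[(a m.+1).+1]addn1 natrD; ring.
Qed.

Lemma heis_comm m n f : heis m (heis n f) - heis n (heis m f) =
  (m%:~R * kw * (m + n == 0)%:R) *: f.
Proof.
have [->|mn] := eqVneq m n.
  have -> : (n + n == 0) = (n == 0) by lia.
  rewrite subrr.
  by case: eqP => [->|_]; rewrite ?mul0r ?mulr0 scale0r.
have [mnN|mnN] := eqVneq `|m|%N `|n|%N; last first.
  have -> : (m + n == 0) = false by lia.
  rewrite mulr0 scale0r; apply/eqP; rewrite subr_eq0; apply/eqP/funext=> a.
  rewrite /heis !scalerA !mode_coef_shift // 1?eq_sym // mulrC.
  by rewrite mode_shiftC // eq_sym.
have -> : m + n == 0 by lia.
rewrite mulr1; have [m0|m0] := boolP (0 < m).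
  have -> : n = - (`|m|%N)%:Z by lia.
  have -> : m = (`|m|%N)%:Z by lia.
  by apply/funext=> a; apply: heis_pair; lia.
have -> : m = - (`|n|%N)%:Z by lia.
have -> : n = (`|n|%N)%:Z by lia.
rewrite -opprB mulrNz mulNr scaleNr; congr (- _).
by apply/funext=> a; apply: heis_pair; lia.
Qed.

End Fock.

(** The tensor product of the Fock module of level [kw] and weight [hw] with a
    module L of level 0: it shifts the weights and the level of L at will. *)
Section FockTensor.
Variables (K : fieldType) (hw kw : K) (L : lmodType K).
Variables (h e : int -> {linear L -> L}).
Hypothesis hh : forall m n u, h m (h n u) = h n (h m u).
Hypothesis he : forall m n u,
  h m (e n u) - e n (h m u) = 2%:R *: e (m + n) u.
Hypothesis ee : forall m n u, e m (e n u) = e n (e m u).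

Definition fock_h (n : int) (f : fock L) : fock L :=
  heis hw kw n f + (h n \o f).

Definition fock_e (n : int) (f : fock L) : fock L := e n \o f.

Lemma fock_h_is_linear n : linear (fock_h n).
Proof.
move=> s f g; rewrite /fock_h heis_is_linear scalerDr addrACA; congr (_ + _).
by apply/funext=> a; apply: (linearP (h n)).
Qed.

Lemma fock_e_is_linear n : linear (fock_e n).
Proof. by move=> s f g; apply/funext=> a; apply: (linearP (e n)). Qed.

Lemma heis_comp n (g : {linear L -> L}) (f : fock L) :
  heis hw kw n (g \o f) = g \o heis hw kw n f.
Proof. by apply/funext=> a; rewrite /heis /= linearZ_LR. Qed.

HB.instance Definition _ n := GRing.isLinear.Build K (fock L) (fock L) *:%R
  (fock_h n) (fock_h_is_linear n).
HB.instance Definition _ n := GRing.isLinear.Build K (fock L) (fock L) *:%R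
  (fock_e n) (fock_e_is_linear n).

Lemma fock_hh m n f :
  fock_h m (fock_h n f) - fock_h n (fock_h m f) =
  (m%:~R * kw * (m + n == 0)%:R) *: f.
Proof.
have hD p q : fock_h p (fock_h q f) =
    heis hw kw p (heis hw kw q f) +
    ((h p \o heis hw kw q f) + (h q \o heis hw kw p f) + (h p \o (h q \o f))).
  rewrite {1}/fock_h linearD /= heis_comp -!addrA; congr (_ + _).
  rewrite addrCA; congr (_ + _); apply/funext=> a; exact: (linearD (h p)).
have hhf : h m \o (h n \o f) = h n \o (h m \o f).
  by apply/funext=> a; apply: hh.
rewrite !hD hhf [h n \o heis _ _ _ _ + _]addrC.
by rewrite opprD addrACA subrr addr0 heis_comm.
Qed.

Lemma fock_he m n f :
  fock_h m (fock_e n f) - fock_e n (fock_h m f) = 2%:R *: fock_e (m + n) f.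
Proof.
have eD : fock_e n (fock_h m f) = (e n \o heis hw kw m f) + (e n \o (h m \o f)).
  by apply/funext=> a; apply: (linearD (e n)).
rewrite eD /fock_h /fock_e heis_comp opprD addrACA subrr add0r.
by apply/funext=> a; apply: he.
Qed.

Lemma fock_ee m n f : fock_e m (fock_e n f) = fock_e n (fock_e m f).
Proof. by apply/funext=> a; apply: ee. Qed.

End FockTensor.

(** * A module of level zero with a nonzero e_{-1} v *)

Section LoopModule.
Variable K : fieldType.

(** Formal sums of the u_j and the w_l: the value of the first component at [j]
    is the coefficient of u_j, and that of the second component at [i] is the
    coefficient of w_{-(i+1)}. *)
Definition loop_module : Type := ((int -> K^o) * (nat -> K^o))%type.
HB.instance Definition _ := GRing.Lmodule.on loop_module.

Definition loop_h (n : int) (u : loop_module) : loop_module :=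
  (fun j => (- 2%:R * (n < 0)%R%:R) * u.1 (j + n),
   fun i => (2%:R * (0 <= n)%R%:R) * u.2 (i + `|n|)%N).

(** Since e_n u_j = w_{n-j}, the coefficient of w_{-(i+1)} comes from
    j = n + i + 1. *)
Definition loop_e (n : int) (u : loop_module) : loop_module :=
  (0, fun i => u.1 (n + i.+1%:Z)).

Lemma fct_linE (T : Type) (s : K) (f g : T -> K^o) i :
  (s *: f + g) i = s * f i + g i.
Proof. by []. Qed.

Lemma loop_h_is_linear n : linear (loop_h n).
Proof.
move=> s u w; congr pair; apply/funext=> i /=.
all: by rewrite !fct_linE mulrDr mulrCA.
Qed.

Lemma loop_e_is_linear n : linear (loop_e n).
Proof.
by move=> s u w; congr pair => //=; rewrite scaler0 addr0.
Qed.

HB.instance Definition _ n := GRing.isLinear.Build K loop_module loop_module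
  *:%R (loop_h n) (loop_h_is_linear n).
HB.instance Definition _ n := GRing.isLinear.Build K loop_module loop_module
  *:%R (loop_e n) (loop_e_is_linear n).

Lemma loop_hh m n u : loop_h m (loop_h n u) = loop_h n (loop_h m u).
Proof.
congr pair; apply/funext=> i /=.
  by rewrite mulrCA addrAC.
by rewrite mulrCA addnAC.
Qed.

Lemma loop_he m n u :
  loop_h m (loop_e n u) - loop_e n (loop_h m u) = 2%:R *: loop_e (m + n) u.
Proof.
congr pair; apply/funext=> i /=.
  rewrite -[LHS]/(_ * 0 - 0) -[RHS]/(2%:R * 0); ring.
rewrite -[LHS]/(2%:R * (0 <= m)%R%:R * u.1 (n + (i + `|m|).+1%:Z) -
  - 2%:R * (m < 0)%R%:R * u.1 (n + i.+1%:Z + m)).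
rewrite -[RHS]/(2%:R * u.1 (m + n + i.+1%:Z)).
have -> : n + i.+1%:Z + m = m + n + i.+1%:Z by ring.
case: m => m.
  have -> : n + (i + `|Posz m|).+1%:Z = Posz m + n + i.+1%:Z by lia.
  by rewrite /=; ring.
by rewrite /=; ring.
Qed.

Lemma loop_ee m n u : loop_e m (loop_e n u) = loop_e n (loop_e m u).
Proof. by []. Qed.

End LoopModule.

(** * The Verma module is not simple *)

Section VermaNotSimple.
Variables (K : fieldType) (hw kw : K).

Definition age_fock_rep : lieRep (aff_age K) (fock (loop_module K)) :=
  age_rep (H := fock_h hw kw (@loop_h K)) (E := fock_e (@loop_e K))
    (fock_hh hw kw (@loop_hh K)) (fock_he hw kw (@loop_he K))
    (fock_ee (@loop_ee K)).

(** The constant series u_0. *)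
Definition vacuum : fock (loop_module K) := fun a =>
  if `[< forall i, a i = 0%N >] then (fun j => (j == 0)%:R, 0) else 0.

Lemma vacuum0 : vacuum (fun _ => 0%N) = (fun j => (j == 0)%:R, 0).
Proof. by rewrite /vacuum asboolT. Qed.

(** For n > 0 no monomial becomes constant by raising an exponent, so the
    derivative of a constant vanishes. *)
Lemma heis_vacuum n : 0 <= n ->
  heis hw kw n vacuum = ((n == 0)%:R * hw) *: vacuum.
Proof.
move=> n0; apply/funext=> a; rewrite -[RHS]/(_ *: vacuum a) /heis /mode_coef.
rewrite ltNge n0 /=; have [->|nn0] := eqVneq n 0.
  rewrite mul1r; congr (_ *: vacuum _).
  by apply/funext=> i; rewrite /mode_shift /= addn0 subn0; case: eqP => // ->.
rewrite mul0r scale0r /vacuum asboolF ?scaler0 // => /(_ `|n|%N).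
by rewrite /mode_shift eqxx; lia.
Qed.

Lemma vacuum_h n : 0 <= n ->
  fock_h hw kw (@loop_h K) n vacuum = ((n == 0)%:R * hw) *: vacuum.
Proof.
move=> n0; rewrite /fock_h heis_vacuum // -[RHS]addr0; congr (_ + _).
apply/funext=> a; rewrite -[RHS]/(0 : loop_module K) /= /vacuum.
case: asboolP => _; last exact: linear0.
congr pair; apply/funext=> i /=; last exact: mulr0.
by rewrite ltNge n0 mulr0 mul0r.
Qed.

Lemma vacuum_e n : 0 <= n -> fock_e (@loop_e K) n vacuum = 0.
Proof.
move=> n0; apply/funext=> a; rewrite -[LHS]/(loop_e n (vacuum a)) /vacuum.
case: asboolP => _; last exact: (linear0 (@loop_e K n)).
congr pair; apply/funext=> i /=.
by case: eqP => //; lia.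
Qed.

Lemma vacuum_weight (x : aff_age_ge0 K) :
  age_fock_rep (verma_incl K x) vacuum = verma_weight hw kw x *: vacuum.
Proof.
set y : affine (age_form K) := verma_incl K x.
have y0 : forall n, n < 0 -> y.1@_n = 0 by apply/aff_ge0P; apply: valP.
rewrite -[LHS]/(age_act _ _ kw y vacuum).
(* The only mode that does not kill the vacuum is isolated by adding 0 to the
   support, where it may be missing. *)
rewrite (@age_actEw _ _ _ _ _ (0%R |` msupp y.1)%fset) ?fsubsetU1 //.
rewrite (big_fsetD1 0) ?fset1U1 //= big_seq big1 => [|n]; last first.
  rewrite !inE => /andP[n0 ny]; rewrite /age_mode.
  have nn : 0 <= n.
    rewrite leNgt; apply: contraTN ny => /y0 yn.
    by rewrite (negPf n0) /= -mcoeff_eq0 yn.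
  rewrite [LHS]/= vacuum_h // vacuum_e // (negPf n0) mul0r scale0r.
  by rewrite !scaler0 addr0.
rewrite /age_mode [LHS]/= vacuum_h // vacuum_e // scaler0 !addr0 mul1r.
rewrite scalerA -scalerDl; congr (_ *: _).
by rewrite /verma_weight mulrC [kw * _]mulrC.
Qed.

(** The series with coefficients in the span of the w_l. *)
Definition bottom_part : {pred fock (loop_module K)} :=
  fun f => `[< forall a, (f a).1 = 0 >].

Lemma bottom_partP f : reflect (forall a, (f a).1 = 0) (f \in bottom_part).
Proof. exact: asboolP. Qed.

Lemma bottom_part_closed : GRing.submod_closed bottom_part.
Proof.
split=> [|s f g /bottom_partP f0 /bottom_partP g0]; apply/bottom_partP=> a //=.
by rewrite f0 g0 scaler0 addr0.
Qed.

Lemma bottom_part_stable x f :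
  f \in bottom_part -> age_fock_rep x f \in bottom_part.
Proof.
apply: age_act_stable => [|n g /bottom_partP g0|n g /bottom_partP g0].
- exact: bottom_part_closed.
- apply/bottom_partP=> a.
  rewrite -[LHS]/((mode_coef hw kw n a *: g (mode_shift n a)).1 +
    (loop_h n (g a)).1) /= g0 scaler0 add0r.
  by apply/funext=> j; rewrite /= g0 mulr0.
- exact/bottom_partP.
Qed.

Theorem verma_not_simple : ~ simple_module (verma hw kw).
Proof.
move=> simp.
have [phi phi1] := verma_lift vacuum_weight.
pose e1 := aff_gen (age_form K) (age_elt K Be) (-1).
have phie : phi (envel_gen (e1 : aff_age K) *: verma_gen hw kw) =
    fock_e (@loop_e K) (-1) vacuum.
  rewrite linearZ phi1 /= envel_gen_act.
  rewrite -[LHS]/(age_act _ _ kw e1 vacuum) age_act_gen /age_mode !ffunE.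
  by rewrite !age_basis_eqE scale0r add0r scale1r.
have : fock_e (@loop_e K) (-1) vacuum = 0.
  rewrite -phie; apply: (simple_module_preim (x := verma_gen hw kw) simp
    (envel_act_stable bottom_part_closed bottom_part_stable)).
    rewrite phi1; apply/negP=> /bottom_partP /(_ (fun=> 0%N)).
    rewrite vacuum0 => /(congr1 (fun f => f 0)) /eqP.
    by rewrite /= oner_eq0.
  by rewrite phie; apply/bottom_partP.
(* The coefficient of w_{-1} in the constant term of e_{-1} v is 1. *)
move/(congr1 (fun f : fock (loop_module K) => (f (fun=> 0%N)).2 0%N)).
rewrite -[LHS]/((vacuum (fun=> 0%N)).1 0) vacuum0 => /eqP.
by rewrite /= oner_eq0.
Qed.

End VermaNotSimple.

Theorem lemma3p1 (R : realType) (h k : R[i]) : ~ simple_module (verma h k).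
Proof. exact: verma_not_simple. Qed.
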